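(* Let $I$ be a set. The contravariant functors $\mathcal{G}_F=\langle\mathcal{G}_0,\mathcal{G}_1\rangle\colon\mathcal{CUV}\to\mathcal{CBA}$ and $\mathcal{F}_F=\langle\mathcal{F}_0,\mathcal{F}_1\rangle\colon\mathcal{CBA}\to\mathcal{CUV}$ constitute a dual equivalence between the categories $\mathcal{CBA}$ and $\mathcal{CUV}$.
   Context: Algebras. A quantifier on a Boolean algebra $A$ (complement written $a^{\perp}$) is a map $\exists\colon A\to A$ with $\exists(a\vee b)=\exists a\vee\exists b$, $\exists0=0$, $\exists\exists a=\exists a$, $a\le\exists a$, $\exists(\exists a)^{\perp}=(\exists a)^{\perp}$. An $I$-dimensional cylindric Boolean algebra is a Boolean algebra $A$ with unary operators $(\exists_i)_{i\in I}$ and constants $(\delta_{i,k})_{i,k\in I}$ such that for all $i,k,l\in I$ and $a\in A$: (1) $\exists_i$ is a quantifier; (2) $\exists_i\exists_ka=\exists_k\exists_ia$; (3) $\delta_{i,k}=\delta_{k,i}$, $\delta_{i,i}=1$; (4) if $k\neq i$ and $k\ne l$, then $\delta_{i,l}=\exists_k(\delta_{i,k}\wedge\delta_{k,l})$; (5) if $i\ne k$, then $\exists_i(\delta_{i,k}\wedge a)\wedge\exists_i(\delta_{i,k}\wedge a^{\perp})=0$. Homomorphisms are Boolean homomorphisms preserving every $\exists_i$ and every $\delta_{i,k}$. $\mathcal{CBA}$ is the category of $I$-dimensional cylindric Boolean algebras and homomorphisms. Spaces. For a $T_0$-space $X$ with specialization order $\leqslant$ ($x\leqslant y$ iff every open set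 containing $x$ contains $y$), let $\text{Int}_{\leqslant}(U)=\{x:y\in U\text{ for all }y\geqslant x\}$, $\text{Cl}_{\leqslant}(U)=\{x:y\in U\text{ for some }y\geqslant x\}$, $U^*=\text{Int}_{\leqslant}(X\setminus U)$. $\mathcal{REG}(X)$ is the set of regular open subsets of the upset topology of $(X,\leqslant)$, i.e. upsets $U$ with $\text{Int}_{\leqslant}(\text{Cl}_{\leqslant}(U))=U$, equivalently $U^{**}=U$. $\mathcal{CO}(X)$ is the set of compact open subsets of $X$, $\mathcal{COREG}(X)=\mathcal{CO}(X)\cap\mathcal{REG}(X)$, $\mathcal{COREG}_X(x)=\{U\in\mathcal{COREG}(X):x\in U\}$. A UV-space is a $T_0$-space $X$ such that $\mathcal{COREG}(X)$ is closed under $\cap$ and $\text{Int}_{\leqslant}(X\setminus\cdot)$ and is a basis for $X$, and every proper filter in $\mathcal{COREG}(X)$ is $\mathcal{COREG}_X(x)$ for some $x\in X$ (filters are non-empty). For a relation $S$, $S[U]=\{y:xSy\text{ for some }x\in U\}$, and $\exists_SU=S[U]$; $\exists_S[\mathcal{COREG}_X(x)]=\{\exists_SU:U\in\mathcal{COREG}_X(x)\}$. An $I$-dimensional cylindric UV-space is $\langle X;(S_i)_{i\in I},(\Delta_{i,k})_{i,k\in I},\tau\rangle$ such that for all $i,k,l\in I$: (1) $\langle X;\tau\rangle$ is a UV-space; (2) $S_i$ is an equivalence relation; (3) $S_i\circ S_k=S_k\circ S_i$; (4) $\Delta_{i,k}\subseteq X$, $\Delta_{i,k}^{**}=\Delta_{i,k}=\Delta_{k,i}$,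 $\Delta_{i,i}=X$; (5) if $i\neq k$ and $l\ne k$, $S_k[\Delta_{i,k}\cap\Delta_{k,l}]=\Delta_{i,l}$; (6) if $i\ne k$, then $S_i[\Delta_{i,k}\cap U]\cap S_i[\Delta_{i,k}\cap U^*]=\emptyset$ for all $U\in\mathcal{COREG}(X)$; (7) $S_i[U]\in\mathcal{COREG}(X)$ for $U\in\mathcal{COREG}(X)$; (8) if not $xS_iy$, then $\exists_{S_i}[\mathcal{COREG}_X(x)]\ne\exists_{S_i}[\mathcal{COREG}_X(y)]$; (9) $\Delta_{i,k}\in\mathcal{CO}(X)$. Maps. A cylindric UV-map $f\colon X\to X'$ between $I$-dimensional cylindric UV-spaces satisfies, for all $i,k\in I$: (1) $f^{-1}[U]\in\mathcal{CO}(X)$ for all $U\in\mathcal{CO}(X')$; (2) if $f(x)\leqslant' y'$, there is $y\in X$ with $x\leqslant y$ and $f(y)=y'$; (3) $S_i[f^{-1}[U]]=f^{-1}[S'_i[U]]$ for all $U\in\mathcal{COREG}(X')$; (4) $f^{-1}[\Delta'_{i,k}]=\Delta_{i,k}$. $\mathcal{CUV}$ is the category of $I$-dimensional cylindric UV-spaces and cylindric UV-maps. Functors. $\mathcal{G}_0(X)=\langle\mathcal{COREG}(X);\cap,\sqcup,{}^*,\emptyset,X,(\exists_{S_i})_{i\in I},(\Delta_{i,k})_{i,k\in I}\rangle$ with $U\sqcup V=\text{Int}_{\leqslant}(\text{Cl}_{\leqslant}(U\cup V))$, and $\mathcal{G}_1(f)=f^{-1}$. $\mathcal{F}_0(A)=\langle\mathfrak{F}(A);(S_i)_{i\in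 I},(\Delta_{i,k})_{i,k\in I},\tau(\beta)\rangle$, where $\mathfrak{F}(A)$ is the set of non-empty proper filters of $A$; $xS_iy$ iff $\{\exists_ia:a\in x\}=\{\exists_ia:a\in y\}$; $\Delta_{i,k}=\phi(\delta_{i,k})$; and $\tau(\beta)$ is the topology with basis $\{\phi(a):a\in A\}$, $\phi(a)=\{x\in\mathfrak{F}(A):a\in x\}$. $\mathcal{F}_1(h)=h^{-1}$ (i.e. $x\mapsto h^{-1}[x]$). *)

(* Defs.v *)
From HB Require Import structures.
From mathcomp Require Import all_boot all_order all_classical.
From mathcomp Require Import topology.

Set Implicit Arguments.
Unset Strict Implicit.
Unset Printing Implicit Defensive.

Import Order.TTheory.
Local Open Scope classical_set_scope.

(** * Categories and dual equivalences *)

Record category := Category {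
  obj :> Type;
  hom : obj -> obj -> Type;
  idm : forall a, hom a a;
  comp : forall a b c, hom b c -> hom a b -> hom a c;
  comp1m : forall a b (f : hom a b), comp (idm b) f = f;
  compm1 : forall a b (f : hom a b), comp f (idm a) = f;
  compA : forall a b c d (f : hom a b) (g : hom b c) (h : hom c d),
    comp h (comp g f) = comp (comp h g) f }.
Arguments hom {c0} : rename.
Arguments idm {c0} : rename.
Arguments comp {c0 a b c} : rename.

Definition is_iso (C : category) (a b : C) (f : hom a b) : Prop :=
  exists g : hom b a, comp g f = idm a /\ comp f g = idm b.

Record functor (C D : category) := Functor {
  fobj :> C -> D;
  fmap : forall a b, hom a b -> hom (fobj a) (fobj b);
  fmap1 : forall a, fmap (idm a) = idm (fobj a);
  fmapM : forall a b c (g : hom b c) (f : hom a b),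
    fmap (comp g f) = comp (fmap g) (fmap f) }.
Arguments fmap {C D} _ {a b}.

Record cofunctor (C D : category) := Cofunctor {
  cobj :> C -> D;
  cmap : forall a b, hom a b -> hom (cobj b) (cobj a);
  cmap1 : forall a, cmap (idm a) = idm (cobj a);
  cmapM : forall a b c (g : hom b c) (f : hom a b),
    cmap (comp g f) = comp (cmap f) (cmap g) }.
Arguments cmap {C D} _ {a b}.

Definition id_functor (C : category) : functor C C :=
  @Functor C C id (fun _ _ f => f) (fun=> erefl) (fun _ _ _ _ _ => erefl).

Section CompCofunctor.
Variables (C D E : category) (G : cofunctor D E) (F : cofunctor C D).

Let cc_map (a b : C) (f : hom a b) : hom (G (F a)) (G (F b)) :=
  cmap G (cmap F f).

Fact cc_map1 a : cc_map (idm a) = idm (G (F a)).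
Proof. by rewrite /cc_map !cmap1. Qed.

Fact cc_mapM a b c (g : hom b c) (f : hom a b) :
  cc_map (comp g f) = comp (cc_map g) (cc_map f).
Proof. by rewrite /cc_map !cmapM. Qed.

Definition comp_cofunctor : functor C E := Functor cc_map1 cc_mapM.
End CompCofunctor.

Definition naturally_isomorphic (C D : category) (F G : functor C D) : Prop :=
  exists eta : forall a, hom (F a) (G a),
    (forall a b (f : hom a b),
       comp (fmap G f) (eta a) = comp (eta b) (fmap F f)) /\
    (forall a, is_iso (eta a)).

Definition dual_equivalence (C D : category)
    (G : cofunctor C D) (F : cofunctor D C) : Prop :=
  naturally_isomorphic (comp_cofunctor G F) (id_functor D) /\
  naturally_isomorphic (comp_cofunctor F G) (id_functor C).

(** * Cylindric Boolean algebras *)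

(* A Boolean algebra is a ctbDistrLatticeType; the one-element algebra is
   allowed, and corresponds to the empty space. *)
Record is_quantifier d (A : ctbDistrLatticeType d) (ex : A -> A) : Prop := {
  quant_join : forall a b, ex (a `|` b)%O = (ex a `|` ex b)%O;
  quant_bot : ex \bot%O = \bot%O;
  quant_idem : forall a, ex (ex a) = ex a;
  quant_le : forall a, (a <= ex a)%O;
  quant_compl : forall a, ex (~` (ex a))%O = (~` (ex a))%O }.

Record is_cba (I : Type) d (A : ctbDistrLatticeType d)
    (ex : I -> A -> A) (diag : I -> I -> A) : Prop := {
  cba_quant : forall i, is_quantifier (ex i);
  cba_exC : forall i k a, ex i (ex k a) = ex k (ex i a);
  cba_diagC : forall i k, diag i k = diag k i;
  cba_diagxx : forall i, diag i i = \top%O;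
  cba_diag_ex : forall i k l, k <> i -> k <> l ->
    diag i l = ex k (diag i k `&` diag k l)%O;
  cba_diag_compl : forall i k a, i <> k ->
    (ex i (diag i k `&` a) `&` ex i (diag i k `&` ~` a))%O = \bot%O }.

Record cba (I : Type) := Cba {
  cba_disp : Order.disp_t;
  cba_sort :> ctbDistrLatticeType cba_disp;
  cba_ex : I -> cba_sort -> cba_sort;
  cba_diag : I -> I -> cba_sort;
  cba_axioms : is_cba cba_ex cba_diag }.
Arguments cba_ex {I} _.
Arguments cba_diag {I} _.

Record is_cba_hom (I : Type) (A B : cba I) (h : A -> B) : Prop := {
  cba_homI : {morph h : a b / (a `&` b)%O};
  cba_homU : {morph h : a b / (a `|` b)%O};
  cba_homC : {morph h : a / (~` a)%O};
  cba_hom0 : h \bot%O = \bot%O;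
  cba_hom1 : h \top%O = \top%O;
  cba_hom_ex : forall i a, h (cba_ex A i a) = cba_ex B i (h a);
  cba_hom_diag : forall i k, h (cba_diag A i k) = cba_diag B i k }.

Record cba_hom (I : Type) (A B : cba I) := CbaHom {
  cba_fun :> A -> B;
  cba_funP : is_cba_hom cba_fun }.

Section CBA.
Variable I : Type.

Lemma cba_hom_ext (A B : cba I) (g h : cba_hom A B) : g =1 h -> g = h.
Proof.
case: g h => g gP [h hP] /= /funext gh; case: _ / gh in hP *.
by congr CbaHom; exact: Prop_irrelevance.
Qed.

Lemma cba_idP (A : cba I) : is_cba_hom (@id A).
Proof. by split. Qed.

Lemma cba_compP (A B C : cba I) (g : cba_hom B C) (f : cba_hom A B) :
  is_cba_hom (g \o f).
Proof.
case: (cba_funP g) (cba_funP f) => gI gU gC g0 g1 ge gd [fI fU fC f0 f1 fe fd].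
split=> [a b|a b|a|||i a|i k] /=.
- by rewrite fI gI.
- by rewrite fU gU.
- by rewrite fC gC.
- by rewrite f0.
- by rewrite f1.
- by rewrite fe ge.
- by rewrite fd gd.
Qed.

Definition CBA : category.
Proof.
refine (@Category (cba I) (@cba_hom I) (fun A => CbaHom (cba_idP A))
  (fun A B C g f => CbaHom (cba_compP g f)) _ _ _);
  by move=> *; apply: cba_hom_ext.
Defined.
End CBA.

(** * UV-spaces *)

Section Spaces.
Variable X : topologicalType.
Implicit Types (x y : X) (U V : set X).

Definition spec_le x y : Prop := forall U, open U -> U x -> U y.

Definition IntLe U : set X := [set x | forall y, spec_le x y -> U y].
Definition ClLe U : set X := [set x | exists2 y, spec_le x y & U y].
Definition rstar U : set X := IntLe (~` U).

Definition upset U : Prop := forall x y, spec_le x y -> U x -> U y.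
Definition REG : set (set X) := [set U | upset U /\ IntLe (ClLe U) = U].
(* compact is the library's filter-theoretic quasi-compactness: no separation
   axiom is involved. *)
Definition CO : set (set X) := [set U | compact U /\ open U].
Definition COREG : set (set X) := CO `&` REG.
Definition COREG_at x : set (set X) := [set U | COREG U /\ U x].

(* A family of sets that is a filter in the poset COREG, not a filter of
   subsets of X; the whole of COREG is the improper filter. *)
Definition COREG_filter (F : set (set X)) : Prop :=
  [/\ F `<=` COREG, F !=set0,
      forall U V, F U -> COREG V -> U `<=` V -> F V &
      forall U V, F U -> F V -> F (U `&` V)].

Record is_uv : Prop := {
  uv_T0 : kolmogorov_space X;
  uv_setI : forall U V, COREG U -> COREG V -> COREG (U `&` V);
  uv_rstar : forall U, COREG U -> COREG (rstar U);
  uv_basis : basis COREG;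
  uv_filter : forall F, COREG_filter F -> F <> COREG ->
    exists x, F = COREG_at x }.

Definition rimg (S : X -> X -> Prop) U : set X :=
  [set y | exists2 x, U x & S x y].
Definition rcomp (S T : X -> X -> Prop) : X -> X -> Prop :=
  fun x z => exists2 y, S x y & T y z.

Lemma spec_le_refl x : spec_le x x.
Proof. by []. Qed.

Lemma spec_le_trans x y z : spec_le x y -> spec_le y z -> spec_le x z.
Proof. by move=> xy yz U oU /(xy _ oU)/(yz _ oU). Qed.

Lemma open_upset U : open U -> upset U.
Proof. by move=> oU x y; apply. Qed.

Lemma IntLe_upset U : upset (IntLe U).
Proof. by move=> x y xy Ux z yz; apply: Ux; exact: spec_le_trans xy yz. Qed.

Lemma rstarK U : rstar (rstar U) = IntLe (ClLe U).
Proof.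
apply/seteqP; split=> x Ux y /Ux /=.
  by move/existsNP=> [z /not_implyP[yz /contrapT Uz]]; exists z.
by move=> [z yz Uz] /(_ z yz); apply.
Qed.

End Spaces.

(** The Boolean algebra of compact open regular open sets of a UV-space *)

Fact coreg_display : Order.disp_t. Proof. exact: Order.Disp tt tt. Qed.

Definition coreg_alg (X : topologicalType) (uvX : is_uv X) : Type := @COREG X.

Section CoregAlgebra.
Variables (X : topologicalType) (uvX : is_uv X).
Local Notation B := (coreg_alg uvX).
Implicit Types U V W : B.

HB.instance Definition _ := Choice.copy B (@COREG X).

Let coregP U : COREG (val U). Proof. exact: set_mem (valP U). Qed.

Let in_coreg (U : set X) (CU : COREG U) : B := exist _ U (mem_set CU).

Fact coreg_join_subproof U V : COREG (IntLe (ClLe (val U `|` val V))).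
Proof.
rewrite -rstarK.
suff -> : rstar (val U `|` val V) = rstar (val U) `&` rstar (val V).
  by apply/(uv_rstar uvX)/(uv_setI uvX); apply/(uv_rstar uvX).
apply/seteqP; split=> x.
  by move=> h; split=> y xy Uy; apply: (h y xy); [left|right].
by move=> [hU hV] y xy [/(hU y xy)|/(hV y xy)].
Qed.

Fact coreg_bot_subproof : COREG (set0 : set X).
Proof.
split; first by split; [exact: compact0|exact: open0].
split; first by move=> x y _ [].
apply/seteqP; split=> x; last by [].
by move=> /(_ x (@spec_le_refl _ x)) [].
Qed.

Fact coreg_top_subproof : COREG (setT : set X).
Proof.
suff <- : rstar (set0 : set X) = setT.
  exact/(uv_rstar uvX)/coreg_bot_subproof.
by apply/seteqP; split=> x // _ y _ [].
Qed.

Definition coreg_le U V : bool := `[< val U `<=` val V >].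
Definition coreg_lt U V : bool := (V != U) && coreg_le U V.
Definition coreg_meet U V : B := in_coreg (uv_setI uvX (coregP U) (coregP V)).
Definition coreg_join U V : B := in_coreg (coreg_join_subproof U V).
Definition coreg_compl U : B := in_coreg (uv_rstar uvX (coregP U)).
Definition coreg_bot : B := in_coreg coreg_bot_subproof.
Definition coreg_top : B := in_coreg coreg_top_subproof.

Let coreg_up U : upset (val U).
Proof. by have [_ []] := coregP U. Qed.

Let coreg_ro U x : (forall y, spec_le x y -> exists2 z, spec_le y z & val U z) ->
  val U x.
Proof. by have [_ [_ {2}<-]] := coregP U. Qed.

Fact coreg_leE U V : coreg_le U V = (coreg_meet U V == U).
Proof.
apply/asboolP/eqP => [UV|<-]; last exact: subIsetr.
by apply: val_inj => /=; exact: setIidl.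
Qed.

Fact coreg_meetC : commutative coreg_meet.
Proof. by move=> U V; apply: val_inj; exact: setIC. Qed.

Fact coreg_meetA : associative coreg_meet.
Proof. by move=> U V W; apply: val_inj; exact: setIA. Qed.

Fact coreg_meetxx : idempotent_op coreg_meet.
Proof. by move=> U; apply: val_inj; exact: setIid. Qed.

Fact coreg_joinC : commutative coreg_join.
Proof. by move=> U V; apply: val_inj; rewrite /= setUC. Qed.

Let IntClU (P Q : set X) : upset P ->
  IntLe (ClLe (IntLe (ClLe P) `|` Q)) = IntLe (ClLe (P `|` Q)).
Proof.
move=> upP; apply/seteqP; split=> x h y /h [z yz].
  move=> [/(_ z (@spec_le_refl _ z))[w zw Pw]|Qz].
    by exists w; [exact: spec_le_trans zw|left].
  by exists z => //; right.
case=> [Pz|Qz]; exists z => //; [left|by right] => w zw.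
by exists w => //; exact: upP Pz.
Qed.

Let upsetU U V : upset (val U `|` val V).
Proof. by move=> x y xy [/(coreg_up xy)|/(coreg_up xy)] h; [left|right]. Qed.

Fact coreg_joinA : associative coreg_join.
Proof.
move=> U V W; apply: val_inj => /=.
rewrite [in RHS]IntClU; last exact: upsetU.
by rewrite setUC IntClU; [rewrite setUC setUA|exact: upsetU].
Qed.

Let sub_join U V : val U `|` val V `<=` val (coreg_join U V).
Proof. by move=> x Ux y xy; exists y => //; exact: upsetU Ux. Qed.

Fact coreg_joinKI V U : coreg_meet U (coreg_join U V) = U.
Proof.
apply: val_inj; apply: setIidl => x Ux.
by apply: sub_join; left.
Qed.

Fact coreg_meetKU V U : coreg_join U (coreg_meet U V) = U.
Proof.
apply: val_inj; apply/seteqP; split=> x => [h|Ux]; last first.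
  by apply: sub_join; left.
by apply: coreg_ro => y /h[z yz [|[]]]; exists z.
Qed.

Fact coreg_meetUl : left_distributive coreg_meet coreg_join.
Proof.
move=> U V W; apply: val_inj; apply/seteqP; split=> x.
  move=> [h Wx] y xy; have [z yz UVz] := h y xy; exists z => //.
  have Wz : val W z by exact/(coreg_up yz)/(coreg_up xy).
  by case: UVz; [left|right].
move=> h; split.
  by move=> y /h[z yz [[? ?]|[? ?]]]; exists z => //; [left|right].
by apply: coreg_ro => y /h[z yz [[]|[]]]; exists z.
Qed.

HB.instance Definition _ := Order.isMeetJoinDistrLattice.Build
  coreg_display B coreg_leE (fun _ _ => erefl)
  coreg_meetC coreg_joinC coreg_meetA coreg_joinA coreg_joinKI coreg_meetKU
  coreg_meetUl coreg_meetxx.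

Fact coreg_le0x U : (coreg_bot <= U)%O.
Proof. by apply/asboolP. Qed.

Fact coreg_lex1 U : (U <= coreg_top)%O.
Proof. by apply/asboolP. Qed.

HB.instance Definition _ := Order.hasBottom.Build coreg_display B coreg_le0x.
HB.instance Definition _ := Order.hasTop.Build coreg_display B coreg_lex1.

Fact coreg_joinxC U : (U `|` coreg_compl U = \top)%O.
Proof.
suff UT : coreg_join U (coreg_compl U) = coreg_top by [].
apply: val_inj; apply/seteqP; split=> x // _ y _.
have [[z yz Uz]|h] := pselect (ClLe (val U) y); first by exists z => //; left.
by exists y => //; right=> z yz Uz; apply: h; exists z.
Qed.

Fact coreg_meetxC U : (U `&` coreg_compl U = \bot)%O.
Proof.
suff U0 : coreg_meet U (coreg_compl U) = coreg_bot by [].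
apply: val_inj; apply/seteqP; split=> x // [Ux].
by move=> /(_ x (@spec_le_refl _ x)).
Qed.

HB.instance Definition _ := Order.TBDistrLattice_hasComplement.Build
  coreg_display B coreg_joinxC coreg_meetxC.

End CoregAlgebra.

(** * Cylindric UV-spaces *)

Record is_cuv (I : Type) (X : topologicalType) (S : I -> X -> X -> Prop)
    (Delta : I -> I -> set X) : Prop := {
  cuv_uv : is_uv X;
  cuv_equiv : forall i, RelationClasses.Equivalence (S i);
  cuv_rcompC : forall i k, rcomp (S i) (S k) = rcomp (S k) (S i);
  cuv_DeltaK : forall i k, rstar (rstar (Delta i k)) = Delta i k;
  cuv_DeltaC : forall i k, Delta i k = Delta k i;
  cuv_Deltaxx : forall i, Delta i i = setT;
  cuv_Delta_img : forall i k l, i <> k -> l <> k ->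
    rimg (S k) (Delta i k `&` Delta k l) = Delta i l;
  cuv_Delta_rstar : forall i k U, i <> k -> COREG U ->
    rimg (S i) (Delta i k `&` U) `&` rimg (S i) (Delta i k `&` rstar U) = set0;
  cuv_img : forall i U, COREG U -> COREG (rimg (S i) U);
  cuv_sep : forall i x y, ~ S i x y ->
    rimg (S i) @` COREG_at x <> rimg (S i) @` COREG_at y;
  cuv_DeltaCO : forall i k, CO (Delta i k) }.

Record cuv (I : Type) := Cuv {
  cuv_sort :> topologicalType;
  cuv_rel : I -> cuv_sort -> cuv_sort -> Prop;
  cuv_Delta : I -> I -> set cuv_sort;
  cuv_axioms : is_cuv cuv_rel cuv_Delta }.
Arguments cuv_rel {I} _.
Arguments cuv_Delta {I} _.

Record is_cuv_map (I : Type) (X Y : cuv I) (f : X -> Y) : Prop := {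
  cuv_mapCO : forall U, CO U -> CO (f @^-1` U);
  cuv_map_lift : forall x y', spec_le (f x) y' ->
    exists2 y, spec_le x y & f y = y';
  cuv_map_img : forall i U, COREG U ->
    rimg (cuv_rel X i) (f @^-1` U) = f @^-1` (rimg (cuv_rel Y i) U);
  cuv_map_Delta : forall i k, f @^-1` (cuv_Delta Y i k) = cuv_Delta X i k }.

Record cuv_map (I : Type) (X Y : cuv I) := CuvMap {
  cuv_fun :> X -> Y;
  cuv_funP : is_cuv_map cuv_fun }.

Section CUV.
Variable I : Type.

Lemma cuv_map_ext (X Y : cuv I) (f g : cuv_map X Y) : f =1 g -> f = g.
Proof.
case: f g => f fP [g gP] /= /funext fg; case: _ / fg in gP *.
by congr CuvMap; exact: Prop_irrelevance.
Qed.

Lemma cuv_map_mono (X Y : cuv I) (f : cuv_map X Y) x y :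
  spec_le x y -> spec_le (f x) (f y).
Proof.
move=> xy V oV Vfx; have [_ Yb] := uv_basis (cuv_uv (cuv_axioms Y)).
have [W [CW Wfx] WV] := Yb (f x) V (open_nbhs_nbhs (conj oV Vfx)).
have [_ ofW] := cuv_mapCO (cuv_funP f) CW.1.
exact/WV/(xy _ ofW).
Qed.

Lemma cuv_map_COREG (X Y : cuv I) (f : cuv_map X Y) U :
  COREG U -> COREG (f @^-1` U).
Proof.
move=> [CU [_ RU]]; have CfU := cuv_mapCO (cuv_funP f) CU; split=> //.
have upfU := open_upset CfU.2; split=> //; apply/seteqP; split=> x.
  move=> h /=; rewrite -RU => y' /(cuv_map_lift (cuv_funP f))[y xy <-].
  by have [z yz Uz] := h y xy; exists (f z) => //; exact: cuv_map_mono.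
by move=> Ux y xy; exists y => //; exact: upfU Ux.
Qed.

Lemma cuv_idP (X : cuv I) : is_cuv_map (@id X).
Proof. by split=> // x y' xy; exists y'. Qed.

Lemma cuv_compP (X Y Z : cuv I) (g : cuv_map Y Z) (f : cuv_map X Y) :
  is_cuv_map (g \o f).
Proof.
split=> [U CU|x z'|i U CU|i k].
- have CgU := cuv_mapCO (cuv_funP g) CU; exact (cuv_mapCO (cuv_funP f) CgU).
- move=> /(cuv_map_lift (cuv_funP g))[y' /(cuv_map_lift (cuv_funP f))].
  by move=> [y xy <-] <-; exists y.
- have gfE V : (g \o f) @^-1` V = f @^-1` (g @^-1` V) by [].
  have CgU := cuv_map_COREG g CU.
  by rewrite 2!gfE (cuv_map_img (cuv_funP f) _ CgU) (cuv_map_img (cuv_funP g)).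
- by rewrite comp_preimage (cuv_map_Delta (cuv_funP g)) (cuv_map_Delta (cuv_funP f)).
Qed.

Definition CUV : category.
Proof.
refine (@Category (cuv I) (@cuv_map I) (fun X => CuvMap (cuv_idP X))
  (fun X Y Z g f => CuvMap (cuv_compP g f)) _ _ _);
  by move=> *; apply: cuv_map_ext.
Defined.
End CUV.

(** * The functor G *)

Section G.
Variable I : Type.

Definition coreg_of (X : cuv I) : ctbDistrLatticeType coreg_display :=
  coreg_alg (cuv_uv (cuv_axioms X)).

Definition G0_ex (X : cuv I) (i : I) (U : coreg_of X) : coreg_of X :=
  exist _ (rimg (cuv_rel X i) (val U))
    (mem_set (cuv_img (cuv_axioms X) i (set_mem (valP U)))).

Arguments G0_ex X i U : clear implicits.

Fact G0_diag_subproof (X : cuv I) i k : COREG (cuv_Delta X i k).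
Proof.
have CD := cuv_DeltaCO (cuv_axioms X) i k.
split=> //; split; first exact: open_upset CD.2.
by rewrite -rstarK; exact: (cuv_DeltaK (cuv_axioms X)).
Qed.

Definition G0_diag (X : cuv I) (i k : I) : coreg_of X :=
  exist _ (cuv_Delta X i k) (mem_set (G0_diag_subproof X i k)).

Definition G1 (X Y : cuv I) (f : cuv_map X Y) (U : coreg_of Y) : coreg_of X :=
  exist _ (f @^-1` (val U)) (mem_set (cuv_map_COREG f (set_mem (valP U)))).

(* That G0 and G1 land in CBA is kept as hypotheses of the functor: discharging
   them is part of the duality theorem. The functor laws hold outright. *)
Section GFunctor.
Hypothesis G0P : forall X : cuv I, is_cba (G0_ex X) (G0_diag X).

Definition G0 (X : cuv I) : cba I := Cba (G0P X).

Hypothesis G1P : forall (X Y : cuv I) (f : cuv_map X Y),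
  @is_cba_hom I (G0 Y) (G0 X) (G1 f).

Definition G_F : cofunctor (CUV I) (CBA I).
Proof.
refine (@Cofunctor (CUV I) (CBA I) G0 (fun X Y f => CbaHom (G1P f)) _ _);
  by move=> *; apply: cba_hom_ext => U; apply: val_inj.
Defined.
End GFunctor.
End G.

(** * The functor F *)

Definition proper_filter d (A : ctbDistrLatticeType d) (x : set A) : Prop :=
  [/\ x !=set0, forall a b, x a -> (a <= b)%O -> x b,
      forall a b, x a -> x b -> x (a `&` b)%O & x <> setT].

Definition filters d (A : ctbDistrLatticeType d) : Type :=
  [set x : set A | proper_filter x].

Section FilterSpace.
Context d (A : ctbDistrLatticeType d).

HB.instance Definition _ :=
  Choice.copy (filters A) [set x : set A | proper_filter x].

Lemma filtersP (x : filters A) : proper_filter (val x).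
Proof. exact: set_mem (valP x). Qed.

Definition phi (a : A) : set (filters A) := [set x | val x a].

Fact phi_cover : \bigcup_(U in range phi) U = setT.
Proof.
apply/seteqP; split=> x // _; have [[a xa] _ _ _] := filtersP x.
by exists (phi a) => //; exists a.
Qed.

Fact phi_join (U V : set (filters A)) x : range phi U -> range phi V ->
  U x -> V x -> exists W, [/\ range phi W, W x & W `<=` U `&` V].
Proof.
move=> [a _ <-] [b _ <-] xa xb; exists (phi (a `&` b)%O); split.
- by exists (a `&` b)%O.
- by have [_ _ xI _] := filtersP x; exact: xI.
- move=> y yab; have [_ yup _ _] := filtersP y.
  by split; apply: yup yab _; [exact: leIl|exact: leIr].
Qed.

HB.instance Definition _ :=
  @isBaseTopological.Build (filters A) (set (filters A)) (range phi) id
    phi_cover phi_join.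
End FilterSpace.

Section F.
Variable I : Type.

Definition F0_rel (A : cba I) (i : I) (x y : filters A) : Prop :=
  cba_ex A i @` (val x) = cba_ex A i @` (val y).

Definition F0_Delta (A : cba I) (i k : I) : set (filters A) :=
  phi (cba_diag A i k).

Arguments F0_rel A i x y : clear implicits.
Arguments F0_Delta A i k : clear implicits.

Fact F1_subproof (A B : cba I) (h : cba_hom A B) (x : filters B) :
  proper_filter (h @^-1` (val x)).
Proof.
case: (cba_funP h) => hI _ _ h0 h1 _ _; have [[b xb] xup xI xT] := filtersP x.
split=> /=.
- by exists \top%O; rewrite /preimage/= h1; apply: xup xb _; exact: lex1.
- move=> a c xa /meet_idPl ac; apply: xup xa _.
  by apply/meet_idPl; rewrite -hI ac.
- by move=> a c xa xc; rewrite /preimage/= hI; exact: xI.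
- move=> hT; apply: xT; apply/seteqP; split=> // c _.
  have : (h @^-1` val x) \bot%O by rewrite hT.
  by rewrite /preimage/= h0 => x0; apply: xup x0 _; exact: le0x.
Qed.

Definition F1 (A B : cba I) (h : cba_hom A B) (x : filters B) : filters A :=
  exist _ (h @^-1` (val x)) (mem_set (F1_subproof h x)).

(* As for G_F, well-definedness is a hypothesis. *)
Section FFunctor.
Hypothesis F0P : forall A : cba I, is_cuv (F0_rel A) (F0_Delta A).

Definition F0 (A : cba I) : cuv I := Cuv (F0P A).

Hypothesis F1P : forall (A B : cba I) (h : cba_hom A B),
  @is_cuv_map I (F0 B) (F0 A) (F1 h).

Definition F_F : cofunctor (CBA I) (CUV I).
Proof.
refine (@Cofunctor (CBA I) (CUV I) F0 (fun A B h => CuvMap (F1P h)) _ _);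
  by move=> *; apply: cuv_map_ext => x; apply: val_inj.
Defined.
End FFunctor.
End F.

Arguments G0_ex {I} X i U.
Arguments F0_rel {I} A i x y.
Arguments F0_Delta {I} A i k.

(* Main.v *)
Require Import Defs.
From mathcomp Require Import all_boot all_order all_classical.
From mathcomp Require Import topology.

Set Implicit Arguments.
Unset Strict Implicit.
Unset Printing Implicit Defensive.

Import Order.Theory.
Local Open Scope classical_set_scope.

(** The proof works with all proper filters of a Boolean algebra instead of its
    ultrafilters, so that no point has to be maximal.  A point of the filter
    space is enlarged by joining to it the filter generated by another set
    ([filter_sup]): such a join is proper as soon as the two sets have no pair
    of disjoint elements, and the elements of the join are known explicitly.

    Algebras to spaces.  In the space of proper filters the specialization
    order is inclusion, and [phi] turns meets into intersections and
    complements into [rstar].  A compact regular open set [U] is the single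
    set [phi a] for some [a] ([COREG_phi]): the basic open sets inside [U] are
    directed, because [phi] of a join is the regularization of a union, and a
    compact set covered by a directed family of open sets lies in one of them.
    Every quantifier [ex] is the image operator of the relation of having the
    same [ex]-closed elements: if [ex a] is in [y], then [a] and the
    [ex]-closed elements of [y] generate a filter related to [y]
    ([rimg_phi]).  With this the axioms of a cylindric algebra become those of
    a cylindric UV-space one by one; only the commutation of the relations
    requires one more filter to be built ([F0_rel_comp_sub]).

    Spaces to algebras.  Of the axioms of a cylindric algebra, only two do not
    follow at once from those of a cylindric UV-space: the image operator of
    each relation [S] must preserve joins and fix the complements of saturated
    sets.  Both rest on one fact about [S] ([rel_lift]): from [S x y]
    and [y <= y'] one gets [x <= x'] with [S x' y'].  The point [x'] is the one
    whose filter is generated by the neighbourhoods of [x] and the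
    [S]-saturations of those of [y'], and the separation axiom shows that it is
    related to [y'].  Lifting makes the complement of a saturated set saturated
    and makes the image operator preserve regularized unions.

    The units.  [a |-> phi a] is a bijection from an algebra onto the compact
    regular open sets of its filter space.  Sending a point to its filter of
    compact regular open neighbourhoods is a bijection from a UV-space onto the
    filter space of its algebra: it is injective by T0, surjective because
    every proper filter of compact regular open sets is the neighbourhood
    filter of a point.  Both commute with the structure, and both are
    isomorphisms: the inverse of a bijective homomorphism is one ([cba_iso]),
    and so is the inverse of a bijective map that reaches every compact regular
    open set as a preimage ([cuv_iso]). *)

(** * Categories *)

(** The units of the duality go from the identity functor to the composite;
    the definition of a dual equivalence orients them the other way. *)
Lemma naturally_isomorphic_sym (C D : category) (F G : functor C D) :
  naturally_isomorphic F G -> naturally_isomorphic G F.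
Proof.
move=> [eta [etaN etaI]].
have [g gP] : {g : forall a, hom (G a) (F a) & forall a,
    Defs.comp (g a) (eta a) = idm (F a) /\ Defs.comp (eta a) (g a) = idm (G a)}.
  by exists (fun a => sval (cid (etaI a))) => a; case: cid.
exists g; split=> [a b f|a]; last by have [? ?] := gP a; exists (eta a).
have [_ etag] := gP a; have [geta _] := gP b.
rewrite -[Defs.comp (Defs.fmap F f) _]comp1m -geta -Defs.compA.
by rewrite (Defs.compA _ (Defs.fmap F f)) -etaN -Defs.compA etag compm1.
Qed.

(** * Boolean algebras and quantifiers *)

Section Boolean.
Context d (A : ctbDistrLatticeType d).
Implicit Types a b c : A.
Local Open Scope order_scope.

(** Adjunction between meet and implication, the implication from [b] to [c]
    being written with complement and meet only, so that a map
    preserving these two preserves it. *)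
Lemma leI_impl a b c : (a `&` b <= c) = (a <= ~` (b `&` ~` c)).
Proof. by rewrite -[c in LHS]complK -!disj_leC meetA. Qed.

Lemma joinE_compl a b : a `|` b = ~` (~` a `&` ~` b).
Proof. by rewrite complI !complK. Qed.

Section Quantifier.
Variables (ex : A -> A) (exQ : is_quantifier ex).

Lemma quant_mono a b : a <= b -> ex a <= ex b.
Proof. by move=> /join_idPr <-; rewrite (quant_join exQ) leUl. Qed.

(** The inequality from left to right is monotonicity.  For the converse, split
    [a] along [ex b]: the part below the complement of [ex b] contributes
    nothing, because that complement is itself closed. *)
Lemma quant_meet_closed a b : ex (a `&` ex b) = ex a `&` ex b.
Proof.
apply/le_anti/andP; split.
  by rewrite lexI quant_mono ?leIl// -{2}(quant_idem exQ b) quant_mono ?leIr.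
rewrite -{1}[a]meetx1 -(joinxC (ex b)) meetUr (quant_join exQ) meetUl.
rewrite leUx leIl /=.
have /leI2/(_ (lexx (ex b))) : ex (a `&` ~` ex b) <= ~` ex b.
  by rewrite -[leRHS](quant_compl exQ) quant_mono ?leIr.
by move/le_trans; apply; rewrite meetCx le0x.
Qed.

Lemma quant_top : ex \top = \top.
Proof. by apply/le_anti; rewrite lex1 (quant_le exQ). Qed.

Lemma quant_disjoint a b : a `&` ex b = \bot -> ex a `&` ex b = \bot.
Proof. by rewrite -quant_meet_closed => ->; rewrite (quant_bot exQ). Qed.

End Quantifier.
End Boolean.

(** * Topology *)

Section Topology.
Variable X : topologicalType.
Implicit Types U V : set X.

Lemma CO_set0 : CO (set0 : set X).
Proof. exact: (coreg_bot_subproof X).1. Qed.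

(** Otherwise the sets [U `\` V], for [V] in [J], form a filter base on [U];
    a cluster point of it lies in some [V] of [J], which is then a
    neighbourhood disjoint from [U `\` V]. *)
Lemma compact_directed_cover U (J : set (set X)) : compact U -> J !=set0 ->
    (forall V, J V -> open V) ->
    (forall V W, J V -> J W -> exists2 Z, J Z & V `|` W `<=` Z) ->
    U `<=` \bigcup_(V in J) V ->
  exists2 V, J V & U `<=` V.
Proof.
move=> cU J0 Jo Jdir UJ; apply: contrapT => noV.
pose F := filter_from J (fun V => U `\` V).
have FF : ProperFilter F.
  apply: filter_from_proper => [|V JV].
    apply: filter_from_filter => // V W JV JW.
    have [Z JZ VWZ] := Jdir V W JV JW; exists Z => // p [Up nZ].
    by split; split=> // ?; apply: nZ; apply: VWZ; [left|right].
  by apply/set0P/eqP; rewrite setD_eq0 => UV; apply: noV; exists V.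
have [p [Up clp]] : U `&` cluster F !=set0.
  by apply: cU; have [V JV] := J0; exists V => //; exact: subDsetl.
have [V JV Vp] := UJ p Up.
have FV : F (U `\` V) by exists V.
have [q [[_ nVq] Vq]] := clp _ _ FV (open_nbhs_nbhs (conj (Jo V JV) Vp)).
exact: nVq.
Qed.

Lemma rstarS U V : U `<=` V -> rstar V `<=` rstar U.
Proof. by move=> UV x Vx y xy Uy; apply: (Vx y xy); exact: UV. Qed.

Lemma rstarU U V : rstar (U `|` V) = rstar U `&` rstar V.
Proof.
apply/seteqP; split=> x.
  by move=> h; split=> y xy Uy; apply: (h y xy); [left|right].
by move=> [hU hV] y xy [/(hU y xy)|/(hV y xy)].
Qed.

End Topology.

Lemma basis_openP (X : topologicalType) (B : set (set X)) U x :
  basis B -> open U -> U x -> exists V, [/\ B V, V x & V `<=` U].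
Proof.
move=> [_ Bx] oU Ux.
have [V [BV Vx] VU] := Bx x U (open_nbhs_nbhs (conj oU Ux)).
by exists V.
Qed.

Lemma spec_le_basis (X : topologicalType) (B : set (set X)) (x y : X) :
  basis B -> (forall V, B V -> V x -> V y) -> spec_le x y.
Proof.
move=> bB xy U oU Ux; have [V [BV Vx VU]] := basis_openP bB oU Ux.
by apply: VU; exact: xy.
Qed.

(** A compact open set need not belong to the basis, but the open subsets of it
    with compact open preimage form a directed cover, so it is one of them. *)
Lemma preimage_CO (X Y : topologicalType) (f : X -> Y) (B : set (set Y)) :
    basis B -> (forall V, B V -> CO (f @^-1` V)) ->
  forall U, CO U -> CO (f @^-1` U).
Proof.
move=> bB fB U [cU oU].
pose J := [set V | [/\ V `<=` U, open V & CO (f @^-1` V)]].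
suff [V [VU _ fV] UV] : exists2 V, J V & U `<=` V.
  by have <- : V = U by exact/seteqP.
apply: compact_directed_cover => //.
- by exists set0; split=> //; [exact: open0|exact: CO_set0].
- by move=> V [].
- move=> V W [VU oV [cfV ofV]] [WU oW [cfW ofW]]; exists (V `|` W) => //.
  split; first by rewrite subUset.
    exact: openU.
  by split; rewrite preimage_setU; [exact: compactU|exact: openU].
- move=> x Ux; have [V [BV Vx VU]] := basis_openP bB oU Ux.
  by exists V => //; split=> //; [exact: bB.1|exact: fB].
Qed.

Lemma COREG_rstarK (X : topologicalType) (U : set X) :
  COREG U -> rstar (rstar U) = U.
Proof. by move=> [_ [_ UE]]; rewrite rstarK. Qed.

(** * The space of proper filters of a Boolean algebra *)

Section FilterSpace.
Context d (A : ctbDistrLatticeType d).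
Implicit Types (a b c : A) (x y z : filters A).

Lemma filter_le x a b : (a <= b)%O -> val x a -> val x b.
Proof. by have [_ up _ _] := filtersP x => ab xa; exact: up xa ab. Qed.

Lemma filter_meet x a b : val x a -> val x b -> val x (a `&` b)%O.
Proof. by have [_ _ xI _] := filtersP x; exact: xI. Qed.

Lemma filter_bot x : ~ val x \bot%O.
Proof.
move=> x0; have [_ _ _] := filtersP x; apply; apply/seteqP; split=> // a _.
exact: filter_le (le0x a) x0.
Qed.

Lemma filter_top x : val x \top%O.
Proof.
by have [[a xa] _ _ _] := filtersP x; exact: filter_le (lex1 a) xa.
Qed.

Lemma filter_ext x y : (forall a, val x a <-> val y a) -> x = y.
Proof. by move=> xy; apply: val_inj; apply/seteqP; split=> a /xy. Qed.

(** Proper filters with prescribed elements are obtained below as joins of two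
    filters.  Stating the lemma for filter bases, not for filters, lets one of
    the two be a single element or a set of closed elements. *)
Lemma filter_sup (P Q : set A) : P !=set0 -> Q !=set0 ->
    (forall a b, P a -> P b -> P (a `&` b)%O) ->
    (forall a b, Q a -> Q b -> Q (a `&` b)%O) ->
    (forall a b, P a -> Q b -> (a `&` b)%O <> \bot%O) ->
  exists z : filters A,
    forall c, val z c <-> exists a b, [/\ P a, Q b & (a `&` b <= c)%O].
Proof.
move=> [p Pp] [q Qq] PI QI PQ.
pose z := [set c | exists a b, [/\ P a, Q b & (a `&` b <= c)%O]].
have zP : proper_filter z.
  split; first by exists (p `&` q)%O, p, q.
  - move=> a b [s [t [Ps Qt h]]] ab; exists s, t; split=> //.
    exact: le_trans ab.
  - move=> a b [s [t [Ps Qt h]]] [s' [t' [Ps' Qt' h']]].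
    exists (s `&` s')%O, (t `&` t')%O; split; [exact: PI|exact: QI|].
    by rewrite meetACA leI2.
  - move=> zT; have [s [t [Ps Qt]]] : z \bot%O by rewrite zT.
    by rewrite lex0 => /eqP; exact: PQ.
by exists (exist _ z (mem_set zP)).
Qed.

(** This replaces the prime filter theorem: it gives [phiC], hence the
    regularity of every [phi a]. *)
Lemma filter_adjoin x a : ~ val x (~` a)%O ->
  exists2 z : filters A, val x `<=` val z & val z a.
Proof.
move=> xNa; have [|||||z zE] := @filter_sup (val x) [set a].
- by exists \top%O; exact: filter_top.
- by exists a.
- exact: filter_meet.
- by move=> _ _ -> ->; rewrite meetxx.
- by move=> b _ xb -> /eqP; rewrite disj_leC => /filter_le/(_ xb).
exists z => [b xb|]; apply/zE; first by exists b, a; split=> //; exact: leIl.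
by exists \top%O, a; split; [exact: filter_top| |exact: leIr].
Qed.

Lemma principal_filter a : a <> \bot%O ->
  exists z : filters A, forall b, val z b <-> (a <= b)%O.
Proof.
move=> a0; have [|||||z zE] := @filter_sup [set a] [set a].
- by exists a.
- by exists a.
- by move=> _ _ -> ->; rewrite meetxx.
- by move=> _ _ -> ->; rewrite meetxx.
- by move=> _ _ -> ->; rewrite meetxx.
exists z => b; split=> [/zE[_ [_ [-> ->]]]|ab]; first by rewrite meetxx.
by apply/zE; exists a, a; rewrite meetxx.
Qed.

Lemma phiI a b : phi (a `&` b)%O = phi a `&` phi b.
Proof.
apply/seteqP; split=> x; last by case; exact: filter_meet.
by move=> xab; split; apply: filter_le xab; [exact: leIl|exact: leIr].
Qed.

Lemma phi0 : phi \bot%O = set0 :> set (filters A).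
Proof. by apply/seteqP; split=> x // /filter_bot. Qed.

Lemma phi1 : phi \top%O = setT :> set (filters A).
Proof. by apply/seteqP; split=> x // _; exact: filter_top. Qed.

Lemma phi_le a b : phi a `<=` phi b -> (a <= b)%O.
Proof.
have [->|a0] := pselect (a = \bot%O); first by rewrite le0x.
have [z zE] := principal_filter a0 => /(_ z) ab.
by apply/zE/ab/zE.
Qed.

Lemma phi_inj : injective (@phi _ A).
Proof.
by move=> a b ab; apply/le_anti/andP; split; apply: phi_le; rewrite ab.
Qed.

Lemma phi_open a : open (phi a).
Proof. by exists [set phi a]; [move=> _ ->; exists a|rewrite bigcup_set1]. Qed.

Lemma phi_basis : basis (range (@phi _ A)).
Proof.
split=> [_ [a _ <-]|x V]; first exact: phi_open.
rewrite nbhsE => -[W [[D Dphi <-] [U DU Ux]] WV].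
exists U; first by split=> //; exact: Dphi.
by move=> y Uy; apply: WV; exists U.
Qed.

Lemma spec_le_filters x y : spec_le x y <-> val x `<=` val y.
Proof.
split=> [xy a|xy]; first by apply: (xy (phi a)); exact: phi_open.
by apply: (spec_le_basis phi_basis) => _ [a _ <-]; exact: xy.
Qed.

(** A nonempty [phi a] has a least point, the principal filter of [a], every
    neighbourhood of which contains the whole of [phi a]. *)
Lemma phi_compact a : compact (phi a).
Proof.
move=> F FF Fa; have [z za] := filter_ex Fa.
have a0 : a <> \bot%O by move=> a0; apply: (@filter_bot z); rewrite -a0.
have {z za} [p pE] := principal_filter a0.
have pa : phi a p by exact/pE.
exists p; split=> // V W FV pW.
have [_ [[b _ <-] pb] bW] := phi_basis.2 p W pW.
have [z [Vz az]] := filter_ex (filterI FV Fa).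
by exists z; split=> //; apply: bW; apply: filter_le az; exact/pE.
Qed.

(** If the complement of [a] is not in [x], then [x] extends to a filter
    containing [a]. *)
Lemma phiC a : phi (~` a)%O = rstar (phi a).
Proof.
apply/seteqP; split=> x.
  move=> xNa y /spec_le_filters xy ya; apply: (@filter_bot y).
  by rewrite -(meetxC a); apply: filter_meet => //; exact: xy.
move=> h; apply: contrapT => xNa.
by have [z /spec_le_filters xz] := filter_adjoin xNa; exact: h.
Qed.

Lemma phi_COREG a : COREG (phi a).
Proof.
split; first by split; [exact: phi_compact|exact: phi_open].
split; first by apply: open_upset; exact: phi_open.
by rewrite -rstarK -!phiC complK.
Qed.

(** The basic open sets inside a regular open [U] are directed under [phi] of
    joins: the union of [phi a] and [phi b] is in [U], hence so is its
    regularization [phi (a `|` b)].  Compactness then yields one basic set. *)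
Lemma COREG_phi : @COREG (filters A) = range (@phi _ A).
Proof.
apply/seteqP; split=> [U CU|_ [a _ <-]]; last exact: phi_COREG.
have [[cU oU] _] := CU.
pose J := [set V | range (@phi _ A) V /\ V `<=` U].
suff [V [rV VU] UV] : exists2 V, J V & U `<=` V.
  by have <- : V = U by exact/seteqP.
apply: compact_directed_cover => //.
- exists (phi \bot%O); split; first by exists \bot%O.
  by rewrite phi0.
- by move=> _ [[a _ <-] _]; exact: phi_open.
- move=> _ _ [[a _ <-] aU] [[b _ <-] bU]; exists (phi (a `|` b)%O); last first.
    by move=> x []; apply: filter_le; [exact: leUl|exact: leUr].
  split; first by exists (a `|` b)%O.
  rewrite joinE_compl phiC phiI !phiC -rstarU -(COREG_rstarK CU).
  by do 2!apply: rstarS; rewrite subUset.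
- move=> x Ux; have [V [rV Vx VU]] := basis_openP phi_basis oU Ux.
  by exists V.
Qed.

Lemma COREG_eq_phi U : COREG U -> exists a, phi a = U.
Proof. by rewrite COREG_phi => -[a _ aU]; exists a. Qed.

Lemma filters_uv : is_uv (filters A).
Proof.
split.
- move=> x y /eqP xNy.
  have [xy|] := pselect (val x `<=` val y).
    have /existsNP[a /not_implyP[ya xa]] : ~ val y `<=` val x.
      move=> yx; apply: xNy; apply: filter_ext => a.
      by split; [exact: xy|exact: yx].
    exists (phi a); right; rewrite !inE; split=> //.
    exact/open_nbhs_nbhs/(conj (phi_open a)).
  move=> /existsNP[a /not_implyP[xa ya]].
  exists (phi a); left; rewrite !inE; split=> //.
  exact/open_nbhs_nbhs/(conj (phi_open a)).
- move=> _ _ /COREG_eq_phi[a <-] /COREG_eq_phi[b <-].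
  by rewrite -phiI; exact: phi_COREG.
- by move=> _ /COREG_eq_phi[a <-]; rewrite -phiC; exact: phi_COREG.
- by rewrite COREG_phi; exact: phi_basis.
- move=> F [FC [U FU] Fup FI] FT.
  pose z := [set a | F (phi a)].
  have zP : proper_filter z.
    split.
    + by have [a aU] := COREG_eq_phi (FC U FU); exists a; rewrite /z/= aU.
    + move=> a b za ab; apply: Fup za (phi_COREG b) _ => x; exact: filter_le.
    + by move=> a b za zb; rewrite /z/= phiI; exact: FI.
    + move=> zT; apply: FT; apply/seteqP; split=> // V.
      by move=> /COREG_eq_phi[a <-]; have : z a by rewrite zT.
  exists (exist _ z (mem_set zP)); apply/seteqP; split=> V.
    move=> FV; split; first exact: FC.
    by have [a aV] := COREG_eq_phi (FC V FV); rewrite -aV in FV *.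
  by move=> [/COREG_eq_phi[a <-]].
Qed.

End FilterSpace.

(** * Quantifiers as equivalence relations on filters *)

Section QuantifierRelation.
Context d (A : ctbDistrLatticeType d).
Variables (ex : A -> A) (exQ : is_quantifier ex).
Implicit Types (a b c : A) (x y z : filters A).

(** The closed elements are the values of [ex], and [ex] sends a filter onto
    the closed elements that it contains. *)
Lemma quant_relP x y : ex @` val x = ex @` val y <->
  forall a, val x (ex a) <-> val y (ex a).
Proof.
suff sub (u v : filters A) : (forall a, val u (ex a) -> val v (ex a)) <->
    ex @` val u `<=` ex @` val v.
  split=> [xy a|xy].
    by split; apply/sub: a; rewrite xy.
  by apply/seteqP; split; apply/sub => a /xy.
split=> [uv _ [a ua <-]|uv a ua].
  exists (ex a); last exact: quant_idem.
  by apply: uv; exact: filter_le (quant_le exQ a) ua.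
have [b vb ba] : (ex @` val v) (ex a).
  by apply: uv; exists (ex a) => //; exact: quant_idem.
by rewrite -ba; exact: filter_le (quant_le exQ b) vb.
Qed.

(** For the inclusion from right to left, a filter [x] containing [a] and
    related to [y] is generated by [a] and the closed elements of [y].  It is
    proper since [a] disjoint from a closed [b] gives [ex a] disjoint from [b],
    and it has no closed elements besides those of [y] because such an element
    above [a `&` b] is above [ex a `&` b]. *)
Lemma rimg_phi a :
  rimg (fun x y => ex @` val x = ex @` val y) (phi a) = phi (ex a).
Proof.
apply/seteqP; split=> y.
  move=> [x xa /quant_relP xy]; apply/xy.
  exact: filter_le (quant_le exQ a) xa.
move=> ya; have [|||||x xE] :=
    @filter_sup _ _ [set a] [set c | val y c /\ ex c = c].
- by exists a.
- exists (ex a); split=> //; exact: quant_idem.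
- by move=> _ _ -> ->; rewrite meetxx.
- move=> b c [yb eb] [yc ec]; split; first exact: filter_meet.
  by rewrite -{1}ec quant_meet_closed// eb ec.
- move=> _ b -> [yb <-] /(quant_disjoint exQ) ab0.
  apply: (@filter_bot _ _ y); rewrite -ab0; apply: filter_meet => //.
  exact: filter_le (quant_le exQ b) yb.
exists x.
  apply/xE; exists a, (ex a); split; rewrite ?leIl//=.
  by split=> //; exact: quant_idem.
apply/quant_relP => c; split=> [/xE[_ [b [-> [yb <-] abc]]]|yc].
  rewrite -(quant_idem exQ c).
  apply: filter_le (quant_mono exQ abc) _; rewrite quant_meet_closed//.
  by apply: filter_meet => //; exact: filter_le (quant_le exQ b) yb.
apply/xE; exists a, (ex c); split; rewrite ?leIr//=.
by split=> //; exact: quant_idem.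
Qed.

End QuantifierRelation.

Section CylindricFilters.
Variables (I : Type) (A : cba I).
Implicit Types (a b c : A) (x y z : filters A).
Local Notation ex := (cba_ex A).

Let exQ i : is_quantifier (ex i) := cba_quant (cba_axioms A) i.

Lemma F0_rel_phi i a : rimg (F0_rel A i) (phi a) = phi (ex i a).
Proof. exact: rimg_phi. Qed.

(** The intermediate point [w] is generated by the [k]-closed elements of [x]
    and the [i]-closed elements of [z].  The point [y] is used only through
    the two transfers [xz] and [zx], which also show that no new closed
    elements appear in [w]. *)
Lemma F0_rel_comp_sub i k x z : rcomp (F0_rel A i) (F0_rel A k) x z ->
  rcomp (F0_rel A k) (F0_rel A i) x z.
Proof.
move=> [y /(quant_relP (exQ i)) xy /(quant_relP (exQ k)) yz].
have exC := cba_exC (cba_axioms A).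
have xz p : val x p -> ex k p = p -> val z (ex i p).
  move=> xp pk; rewrite -pk exC; apply/yz; rewrite -exC pk; apply/xy.
  exact: filter_le (quant_le (exQ i) p) xp.
have zx q : val z q -> ex i q = q -> val x (ex k q).
  move=> zq qi; rewrite -qi -exC; apply/xy; rewrite exC qi; apply/yz.
  exact: filter_le (quant_le (exQ k) q) zq.
have closedI j p q : ex j p = p -> ex j q = q -> ex j (p `&` q)%O = (p `&` q)%O.
  by move=> pj qj; rewrite -{1}qj (quant_meet_closed (exQ j)) pj qj.
have [|||||w wE] := @filter_sup _ _ [set c | val x c /\ ex k c = c]
    [set c | val z c /\ ex i c = c].
- by exists \top%O; split; [exact: filter_top|exact: quant_top].
- by exists \top%O; split; [exact: filter_top|exact: quant_top].
- by move=> b c [? ?] [? ?]; split; [exact: filter_meet|exact: closedI].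
- by move=> b c [? ?] [? ?]; split; [exact: filter_meet|exact: closedI].
- move=> p q [xp pk] [zq qi]; rewrite -qi => /(quant_disjoint (exQ i)) pq.
  apply: (@filter_bot _ _ z); rewrite -pq.
  by apply: filter_meet; [exact: xz|rewrite qi].
exists w; apply/quant_relP => // c; split.
- move=> xc; apply/wE; exists (ex k c), \top%O; rewrite meetx1; split=> //.
    by split=> //; exact: quant_idem.
  by split; [exact: filter_top|exact: quant_top].
- move=> /wE[p [q [[xp pk] [zq qi] pqc]]].
  rewrite -(quant_idem (exQ k)); apply: filter_le (quant_mono (exQ k) pqc) _.
  rewrite -pk meetC (quant_meet_closed (exQ k)) pk.
  by apply: filter_meet => //; exact: zx.
- move=> /wE[p [q [[xp pk] [zq qi] pqc]]].
  rewrite -(quant_idem (exQ i)); apply: filter_le (quant_mono (exQ i) pqc) _.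
  rewrite -qi (quant_meet_closed (exQ i)) qi.
  by apply: filter_meet => //; exact: xz.
- move=> zc; apply/wE; exists \top%O, (ex i c); rewrite meet1x; split=> //.
    by split; [exact: filter_top|exact: quant_top].
  by split=> //; exact: quant_idem.
Qed.

Lemma F0_cuv : is_cuv (F0_rel A) (F0_Delta A).
Proof.
have axA := cba_axioms A; split.
- exact: filters_uv.
- by move=> i; split=> [x|x y|x y z xy]; rewrite /F0_rel // xy.
- by move=> i k; apply/funext => x; apply/funext => z; apply/propext; split;
    exact: F0_rel_comp_sub.
- by move=> i k; exact/COREG_rstarK/phi_COREG.
- by move=> i k; rewrite /F0_Delta (cba_diagC axA).
- by move=> i; rewrite /F0_Delta (cba_diagxx axA) phi1.
- move=> i k l /nesym ik /nesym lk.
  by rewrite /F0_Delta -phiI F0_rel_phi -(cba_diag_ex axA).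
- move=> i k U ik /COREG_eq_phi[a <-].
  by rewrite -phiC -!phiI !F0_rel_phi -phiI (cba_diag_compl axA)// phi0.
- by move=> i U /COREG_eq_phi[a <-]; rewrite F0_rel_phi; exact: phi_COREG.
- move=> i x y nxy xy; apply: nxy; apply/(quant_relP (exQ i)).
  suff sub u v : rimg (F0_rel A i) @` COREG_at u =
      rimg (F0_rel A i) @` COREG_at v ->
      forall a, val u (ex i a) -> val v (ex i a).
    by move=> a; split; apply: sub.
  move=> {x y xy} uv a ua.
  have : (rimg (F0_rel A i) @` COREG_at u) (phi (ex i a)).
    exists (phi (ex i a)); first by split; [exact: phi_COREG|].
    by rewrite F0_rel_phi (quant_idem (exQ i)).
  rewrite uv => -[_ [/COREG_eq_phi[b <-] vb]].
  rewrite F0_rel_phi => /phi_inj <-.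
  exact: filter_le (quant_le (exQ i) b) vb.
- by move=> i k; exact: (phi_COREG _).1.
Qed.

End CylindricFilters.

(** For the lifting condition, given a filter [y'] containing the preimage of
    [x], take the filter generated by [x] and the image of [y'].  Adjunction
    moves an element of [x] across an inequality and turns it into an
    implication that lies in the preimage of [x], hence in [y']. *)
Lemma F1_cuv_map (I : Type)
    (F0P : forall A : cba I, is_cuv (F0_rel A) (F0_Delta A))
    (A B : cba I) (h : cba_hom A B) :
  @is_cuv_map I (F0 F0P B) (F0 F0P A) (F1 h).
Proof.
case: (cba_funP h) => hI _ hC h0 h1 hex hdiag.
have F1phi a : F1 h @^-1` phi a = phi (h a) by [].
split.
- apply: (preimage_CO (@phi_basis _ A)) => _ [a _ <-].
  by rewrite F1phi; exact: (phi_COREG _).1.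
- move=> x y' /spec_le_filters xy'.
  have [|||||y yE] := @filter_sup _ _ (val x) (h @` val y').
  + by exists \top%O; exact: filter_top.
  + by exists (h \top%O), \top%O => //; exact: filter_top.
  + exact: filter_meet.
  + move=> _ _ [a ya <-] [b yb <-]; exists (a `&` b)%O; last exact: hI.
    exact: filter_meet.
  + move=> b _ xb [a ya <-] /eqP; rewrite disj_leC -hC => bNa.
    apply: (@filter_bot _ _ y'); rewrite -(meetxC a).
    by apply: filter_meet => //; apply: xy'; exact: filter_le bNa xb.
  exists y.
    apply/spec_le_filters => b xb; apply/yE; exists b, (h \top%O).
    split=> //; last exact: leIl.
    by exists \top%O => //; exact: filter_top.
  apply: filter_ext => c; split=> [/yE[b [_ [xb [a ya <-]]]]|yc].
    rewrite leI_impl -!(hC, hI) => /filter_le/(_ xb)/xy' yac.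
    have := filter_meet ya yac; apply: filter_le.
    by rewrite complI complK meetUr meetxC join0x leIr.
  apply/yE; exists \top%O, (h c); split; [exact: filter_top|by exists c|].
  exact: leIr.
- move=> i U /COREG_eq_phi[a <-].
  by rewrite F1phi !F0_rel_phi F1phi hex.
- by move=> i k; rewrite /= /F0_Delta F1phi hdiag.
Qed.

(** * Quantifiers on the compact open regular open sets of a UV-space *)

Section UVSpace.
Variables (X : topologicalType) (uvX : is_uv X).
Implicit Types (x y z : X) (U V W : set X).

Lemma coreg_spec_le x y : (forall U, COREG U -> U x -> U y) -> spec_le x y.
Proof. exact: spec_le_basis (uv_basis uvX). Qed.

Lemma spec_le_coreg x y U : spec_le x y -> COREG U -> U x -> U y.
Proof. by move=> xy [_ [upU _]]; exact: upU. Qed.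

Lemma spec_le_anti x y : spec_le x y -> spec_le y x -> x = y.
Proof.
move=> xy yx; apply/eqP; apply: contrapT => /negP/(uv_T0 uvX)[V].
rewrite !inE !nbhsE => -[] [[W [oW Wp] WV] nV]; apply: nV; apply: WV.
  exact: xy.
exact: yx.
Qed.

(* The hypotheses on [S] are the axioms of a cylindric UV-space that involve a
   single relation. *)
Section Relation.
Variable S : X -> X -> Prop.
Hypothesis Sequiv : RelationClasses.Equivalence S.
Hypothesis Simg : forall U, COREG U -> COREG (rimg S U).
Hypothesis Ssep : forall x y, ~ S x y ->
  rimg S @` COREG_at x <> rimg S @` COREG_at y.

Let Srefl x : S x x. Proof. by case: Sequiv. Qed.
Let Ssym x y : S x y -> S y x. Proof. by case: Sequiv => _ + _; apply. Qed.
Let Strans x y z : S x y -> S y z -> S x z.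
Proof. by case: Sequiv => _ _; apply. Qed.

Lemma rimg_sub U : U `<=` rimg S U.
Proof. by move=> x Ux; exists x. Qed.

Lemma rimg_idem U : rimg S (rimg S U) = rimg S U.
Proof.
apply/seteqP; split; last exact: rimg_sub.
by move=> z [y [x Ux xy] yz]; exists x => //; exact: Strans yz.
Qed.

Lemma rimg_sat U x y : S x y -> rimg S U x -> rimg S U y.
Proof. by move=> xy Ux; rewrite -rimg_idem; exists x. Qed.

(** The separation axiom in positive form: unrelated points are separated by a
    saturated compact regular open set. *)
Lemma rimg_sepP x y :
  (forall U, COREG U -> rimg S U x <-> rimg S U y) -> S x y.
Proof.
move=> xy; apply: contrapT => /Ssep; apply.
suff sub u v : (forall U, COREG U -> rimg S U u <-> rimg S U v) ->
    rimg S @` COREG_at u `<=` rimg S @` COREG_at v.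
  by apply/seteqP; split; apply: sub => U CU; split=> /(xy U CU).
move=> uv _ [U [CU Uu] <-]; exists (rimg S U); last exact: rimg_idem.
by split; [exact: Simg|apply/uv => //; exact: rimg_sub].
Qed.

(** The back condition between [S] and the specialization order.  The filter
    [F] generated by the neighbourhoods [U] of [x] and the saturations of the
    neighbourhoods [V] of [y'] is proper, since the saturation of [U] contains
    [y], hence [y'].  Its point [x'] lies in the saturated sets that contain
    [y'], by construction, and in no others: a saturated set including
    [U `&` rimg S V] meets the class of [y']. *)
Lemma rel_lift x y y' : S x y -> spec_le y y' ->
  exists2 x', spec_le x x' & S x' y'.
Proof.
move=> xy yy'.
pose F := [set W | COREG W /\ exists U V,
  [/\ COREG_at x U, COREG_at y' V & U `&` rimg S V `<=` W]].
have FI U V : COREG_at x U -> COREG_at y' V -> F (U `&` rimg S V).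
  move=> xU yV; split; last by exists U, V; split.
  by apply: (uv_setI uvX); [exact: xU.1|apply: Simg; exact: yV.1].
have atT z : COREG_at z setT by split=> //; exact: coreg_top_subproof.
have [||x' x'E] := uv_filter uvX (F := F).
- split; first by move=> W [].
  + by exists (setT `&` rimg S setT); exact: FI.
  + move=> W W' [_ [U [V [xU yV UV]]]] CW' WW'; split=> //.
    by exists U, V; split=> // p /UV/WW'.
  + move=> W W' [CW [U [V [[CU Ux] [CV Vy] UVW]]]].
    move=> [CW' [U' [V' [[CU' Ux'] [CV' Vy'] UVW']]]].
    split; first exact: (uv_setI uvX).
    exists (U `&` U'), (V `&` V'); split.
    * by split; [exact: (uv_setI uvX)|].
    * by split; [exact: (uv_setI uvX)|].
    * move=> p [[Up U'p] [q [Vq V'q] qp]]; split.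
        by apply: UVW; split=> //; exists q.
      by apply: UVW'; split=> //; exists q.
- move=> FT; have : F set0 by rewrite FT; exact: coreg_bot_subproof.
  move=> [_ [U [V [[CU Ux] [CV Vy'] UV0]]]].
  have Uy' : rimg S U y'.
    by apply: (spec_le_coreg yy' (Simg CU)); exists x.
  case: Uy' => p Up py'; apply: (UV0 p); split=> //.
  by exists y' => //; exact: Ssym.
have F_at W : F W <-> COREG_at x' W by rewrite x'E.
exists x'.
  apply: coreg_spec_le => U CU Ux.
  by have /F_at[_ []] : F (U `&` rimg S setT) by exact: FI.
apply: rimg_sepP => W CW; split=> [Wx'|[q Wq qy']].
  have /F_at[_ [U [V [[CU Ux] [CV Vy'] UVW]]]] : COREG_at x' (rimg S W).
    by split=> //; exact: Simg.
  have [p Up py'] : rimg S U y'.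
    by apply: (spec_le_coreg yy' (Simg CU)); exists x.
  apply: rimg_sat (py') _; apply: UVW; split=> //.
  by exists y' => //; exact: Ssym.
have Wy' : rimg S W y' by exists q.
have /F_at[_ [_]] : F (setT `&` rimg S (rimg S W)).
  by apply: FI; [exact: atT|split=> //; exact: Simg].
by rewrite rimg_idem.
Qed.

Lemma rimg_rstar U : rimg S (rstar (rimg S U)) = rstar (rimg S U).
Proof.
apply/seteqP; split; last exact: rimg_sub.
move=> y [x nUx xy] y' yy' Uy'.
have [x' xx' x'y'] := rel_lift xy yy'.
by apply: (nUx x' xx'); apply: rimg_sat Uy'; exact: Ssym.
Qed.

(** Lifting twice, upwards from [x] and back to [z], gives the inclusion from
    left to right.  The other one holds because the left-hand side is regular
    and includes both images. *)
Lemma rimg_regjoin U V : COREG U -> COREG V ->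
  rimg S (IntLe (ClLe (U `|` V))) = IntLe (ClLe (rimg S U `|` rimg S V)).
Proof.
move=> CU CV; apply/seteqP; split=> z.
  move=> [x UVx xz] z' zz'.
  have [x' xx' x'z'] := rel_lift xz zz'.
  have [x'' x'x'' UVx''] := UVx x' xx'.
  have [z'' z'z'' z''x''] := rel_lift (Ssym x'z') x'x''.
  exists z'' => //.
  by case: UVx'' => [Ux|Vx]; [left|right]; exists x'' => //; exact: Ssym.
move=> h; have CUV : COREG (IntLe (ClLe (U `|` V))).
  rewrite -rstarK rstarU; apply: (uv_rstar uvX).
  by apply: (uv_setI uvX); exact: (uv_rstar uvX).
have subUV : U `|` V `<=` IntLe (ClLe (U `|` V)).
  move=> x UVx y xy; exists y => //.
  by case: UVx => [/(spec_le_coreg xy CU)|/(spec_le_coreg xy CV)]; [left|right].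
rewrite -(COREG_rstarK (Simg CUV)) rstarK => y /h[z' yz' UVz'].
exists z' => //; case: UVz' => -[x Ux xz]; exists x => //; apply: subUV.
  by left.
by right.
Qed.

End Relation.
End UVSpace.

Section G0.
Variables (I : Type) (X : cuv I).
Let axX := cuv_axioms X.
Let uvX := cuv_uv axX.

Lemma coreg_ofP (U : coreg_of X) : COREG (val U).
Proof. exact: set_mem (valP U). Qed.

Lemma G0_cba : is_cba (G0_ex X) (G0_diag X).
Proof.
have eqX := cuv_equiv axX.
have Simg i := @cuv_img _ _ _ _ axX i.
have Ssep i := @cuv_sep _ _ _ _ axX i.
split.
- move=> i; split.
  + move=> U V; apply: val_inj.
    exact: (rimg_regjoin uvX (eqX i) (Simg i) (Ssep i)
      (coreg_ofP U) (coreg_ofP V)).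
  + by apply: val_inj; apply/seteqP; split=> x // [].
  + by move=> U; apply: val_inj; exact: rimg_idem.
  + by move=> U; apply/asboolP; exact: rimg_sub.
  + move=> U; apply: val_inj.
    exact: (rimg_rstar uvX (eqX i) (Simg i) (Ssep i)).
- move=> i k U; apply: val_inj.
  have rimgE j l : rimg (cuv_rel X j) (rimg (cuv_rel X l) (val U)) =
      rimg (rcomp (cuv_rel X l) (cuv_rel X j)) (val U).
    apply/seteqP; split=> z.
      by move=> [y [x Ux xy] yz]; exists x => //; exists y.
    by move=> [x Ux [y xy yz]]; exists y => //; exists x.
  by rewrite /= !rimgE (cuv_rcompC axX).
- by move=> i k; apply: val_inj; exact: (cuv_DeltaC axX).
- by move=> i; apply: val_inj; exact: (cuv_Deltaxx axX).
- move=> i k l /nesym ik /nesym lk; apply: val_inj.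
  by rewrite /= (cuv_Delta_img axX).
- move=> i k U ik; apply: val_inj.
  exact: (cuv_Delta_rstar axX ik (coreg_ofP U)).
Qed.

End G0.

(** Joins are definable from meets and complements.  This spares a direct check
    in [COREG], where joins are regularized unions. *)
Lemma cba_homP (I : Type) (A B : cba I) (h : A -> B) :
    {morph h : a b / (a `&` b)%O} -> {morph h : a / (~` a)%O} ->
    h \bot%O = \bot%O ->
    (forall i a, h (cba_ex A i a) = cba_ex B i (h a)) ->
    (forall i k, h (cba_diag A i k) = cba_diag B i k) ->
  is_cba_hom h.
Proof.
move=> hI hC h0 hex hdiag; split=> //.
  by move=> a b; rewrite !joinE_compl !(hC, hI).
by rewrite -compl0 hC h0 compl0.
Qed.

Lemma cuv_map_rstar (I : Type) (X Y : cuv I) (f : cuv_map X Y) U :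
  f @^-1` (rstar U) = rstar (f @^-1` U).
Proof.
apply/seteqP; split=> x h.
  by move=> y /(cuv_map_mono (f := f)); exact: h.
by move=> y' /(cuv_map_lift (cuv_funP f))[y xy <-]; exact: h.
Qed.

Lemma G1_cba_hom (I : Type)
    (G0P : forall X : cuv I, is_cba (G0_ex X) (G0_diag X))
    (X Y : cuv I) (f : cuv_map X Y) :
  @is_cba_hom I (G0 G0P Y) (G0 G0P X) (G1 f).
Proof.
apply: cba_homP.
- by move=> U V; exact: val_inj.
- by move=> U; apply: val_inj; exact: cuv_map_rstar.
- exact: val_inj.
- move=> i U; apply: val_inj; symmetry.
  exact: (cuv_map_img (cuv_funP f) i (coreg_ofP U)).
- by move=> i k; apply: val_inj; exact: (cuv_map_Delta (cuv_funP f)).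
Qed.

(** * Isomorphisms *)

Lemma cba_iso (I : Type) (A B : cba I) (h : cba_hom A B) :
  injective h -> (forall b, exists a, h a = b) -> @is_iso (CBA I) A B h.
Proof.
move=> hinj /choice[g gK]; case: (cba_funP h) => hI _ hC h0 _ hex hdiag.
have gP : is_cba_hom g.
  apply: cba_homP => [a b|a||i a|i k]; apply: hinj.
  - by rewrite hI !gK.
  - by rewrite hC !gK.
  - by rewrite gK h0.
  - by rewrite hex !gK.
  - by rewrite gK hdiag.
exists (CbaHom gP); split; apply: cba_hom_ext => a //=.
by apply: hinj; rewrite gK.
Qed.

(** A bijective map under which every compact regular open set is a preimage is
    a homeomorphism, hence an order isomorphism, and its inverse takes images
    under the relations to images because the map does. *)
Lemma cuv_iso (I : Type) (X Y : cuv I) (f : cuv_map X Y) :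
    injective f -> (forall y, exists x, f x = y) ->
    (forall U : set X, COREG U -> exists2 V : set Y, COREG V & U = f @^-1` V) ->
  @is_iso (CUV I) X Y f.
Proof.
move=> finj /choice[g gK] fopen.
have gf V : g @^-1` (f @^-1` V) = V.
  by apply/seteqP; split=> y; rewrite /preimage/= gK.
have gP : is_cuv_map g.
  split.
  - have bX := uv_basis (cuv_uv (cuv_axioms X)).
    apply: (preimage_CO bX) => _ /fopen[V CV ->].
    by rewrite gf; exact: CV.1.
  - move=> y x' gyx'; exists (f x'); last by apply: finj; rewrite gK.
    by rewrite -[y]gK; exact: cuv_map_mono.
  - move=> i _ /fopen[V CV ->].
    by rewrite gf (cuv_map_img (cuv_funP f))// gf.
  - by move=> i k; rewrite -(cuv_map_Delta (cuv_funP f)) gf.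
exists (CuvMap gP); split; apply: cuv_map_ext => x //=.
by apply: finj; rewrite gK.
Qed.

(** * Units of the duality *)

Section Duality.
Variable I : Type.
Hypothesis G0P : forall X : cuv I, is_cba (G0_ex X) (G0_diag X).
Hypothesis G1P : forall (X Y : cuv I) (f : cuv_map X Y),
  @is_cba_hom I (G0 G0P Y) (G0 G0P X) (G1 f).
Hypothesis F0P : forall A : cba I, is_cuv (F0_rel A) (F0_Delta A).
Hypothesis F1P : forall (A B : cba I) (h : cba_hom A B),
  @is_cuv_map I (F0 F0P B) (F0 F0P A) (F1 h).

Section AlgebraUnit.
Variable A : cba I.

Definition phi_coreg (a : A) : G0 G0P (F0 F0P A) :=
  exist _ (phi a) (mem_set (phi_COREG a)).

Lemma phi_coreg_hom : is_cba_hom phi_coreg.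
Proof.
apply: cba_homP => [a b|a||i a|i k]; apply: val_inj.
- exact: phiI.
- exact: phiC.
- exact: phi0.
- by symmetry; exact: F0_rel_phi.
- by [].
Qed.

Lemma phi_coreg_iso : @is_iso (CBA I) A _ (CbaHom phi_coreg_hom).
Proof.
apply: cba_iso => [a b /(congr1 val)/phi_inj //|U].
have [a aU] := COREG_eq_phi (coreg_ofP U).
by exists a; exact: val_inj.
Qed.

End AlgebraUnit.

Section SpaceUnit.
Variable X : cuv I.
Let uvX := cuv_uv (cuv_axioms X).
Local Notation B := (G0 G0P X).

Definition coreg_nbhd (x : X) : set B := [set U | val U x].

Fact coreg_nbhd_filter x : proper_filter (coreg_nbhd x).
Proof.
split.
- by exists \top%O.
- by move=> U V Ux /asboolP; apply.
- by move=> U V Ux Vx; split.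
- by move=> xT; have : coreg_nbhd x \bot%O by rewrite xT.
Qed.

Definition nbhd_filter (x : X) : F0 F0P B :=
  exist _ (coreg_nbhd x) (mem_set (coreg_nbhd_filter x)).

Lemma nbhd_filter_phi (U : B) : nbhd_filter @^-1` phi U = val U.
Proof. by []. Qed.

(** This transports the axiom on proper filters of a UV-space from families of
    subsets of [X] to filters of the algebra of compact regular open sets. *)
Lemma nbhd_filter_surj (p : F0 F0P B) : exists x, nbhd_filter x = p.
Proof.
have [[U0 pU0] pup pI pT] := filtersP p.
have inB (V : set X) : COREG V -> exists V' : B, val V' = V.
  by move=> CV; exists (exist _ V (mem_set CV)).
have [||x xE] := uv_filter uvX (F := val @` val p).
- split.
  + by move=> _ [U _ <-]; exact: coreg_ofP.
  + by exists (val U0), U0.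
  + move=> _ V [U pU <-] /inB[V' <-] UV; exists V' => //.
    by apply: pup pU _; exact/asboolP.
  + by move=> _ _ [U pU <-] [V pV <-]; exists (U `&` V)%O => //; exact: pI.
- move=> pC; apply: pT; apply/seteqP; split=> // V _.
  have inp W : COREG W -> (val @` val p) W by rewrite pC.
  by have [U pU /val_inj <-] := inp _ (coreg_ofP V).
exists x; apply: filter_ext => U; split=> [Ux|pU].
  have : COREG_at x (val U) by split=> //; exact: coreg_ofP.
  by rewrite -xE => -[V pV /val_inj <-].
by have : COREG_at x (val U) by [rewrite -xE; exists U]; case.
Qed.

Lemma nbhd_filter_map : is_cuv_map nbhd_filter.
Proof.
split.
- apply: (preimage_CO (@phi_basis _ B)) => _ [U _ <-].
  by rewrite nbhd_filter_phi; exact: (coreg_ofP U).1.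
- move=> x p /spec_le_filters; have [y <-] := nbhd_filter_surj p => xy.
  exists y => //; apply: (coreg_spec_le uvX) => U CU Ux.
  exact: (xy (exist _ U (mem_set CU))).
- by move=> i V /COREG_eq_phi[U <-]; rewrite F0_rel_phi.
- by [].
Qed.

Lemma nbhd_filter_iso : @is_iso (CUV I) X _ (CuvMap nbhd_filter_map).
Proof.
apply: cuv_iso => [x y xy|p|U CU].
- have xyU U : COREG U -> U x = U y.
    move=> CU; pose V : B := exist _ U (mem_set CU).
    exact: (congr1 (fun p : F0 F0P B => val p V) xy).
  by apply: (spec_le_anti uvX); apply: (coreg_spec_le uvX) => U /xyU ->.
- exact: nbhd_filter_surj.
- pose V : B := exist _ U (mem_set CU).
  by exists (phi V) => //; exact: phi_COREG.
Qed.

End SpaceUnit.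

Lemma coreg_filters_dual_equivalence : dual_equivalence (G_F G1P) (F_F F1P).
Proof.
split; apply: naturally_isomorphic_sym.
- exists (fun A => CbaHom (phi_coreg_hom A)); split; last exact: phi_coreg_iso.
  by move=> A B h; apply: cba_hom_ext => a; exact: val_inj.
- exists (fun X => CuvMap (nbhd_filter_map X)).
  split; last exact: nbhd_filter_iso.
  by move=> X Y f; apply: cuv_map_ext => x; apply: val_inj.
Qed.

End Duality.

Theorem theorem7p12 (I : Type) :
  exists (G0P : forall X : cuv I, is_cba (G0_ex X) (G0_diag X))
         (G1P : forall (X Y : cuv I) (f : cuv_map X Y),
                  @is_cba_hom I (G0 G0P Y) (G0 G0P X) (G1 f))
         (F0P : forall A : cba I, is_cuv (F0_rel A) (F0_Delta A))
         (F1P : forall (A B : cba I) (h : cba_hom A B),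
                  @is_cuv_map I (F0 F0P B) (F0 F0P A) (F1 h)),
    dual_equivalence (G_F G1P) (F_F F1P).
Proof.
exists (@G0_cba I), (G1_cba_hom (@G0_cba I)).
exists (@F0_cuv I), (F1_cuv_map (@F0_cuv I)).
exact: coreg_filters_dual_equivalence.
Qed.
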